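(* Let $\eta^{ij}$ be a nondegenerate symmetric constant $N\times N$ matrix. A function $\Phi(u^1,\dots,u^N)$ generates a family of $N$ integrals in involution with respect to the Poisson bracket given by the constant Hamiltonian operator $M_2^{ij}=\eta^{ij}\frac{d}{dx}$, $$I_n=\int\frac{\partial\Phi}{\partial u^n}(u(x))\,dx,\qquad \{I_n,I_m\}=0,\qquad 1\le n,m\le N,$$ if and only if $\Phi(u)$ is a solution of the equations of associativity of two-dimensional topological quantum field theory $$\sum_{m=1}^N\sum_{n=1}^N\eta^{mn}\frac{\partial^3\Phi}{\partial u^i\partial u^j\partial u^m}\frac{\partial^3\Phi}{\partial u^n\partial u^k\partial u^l}=\sum_{m=1}^N\sum_{n=1}^N\eta^{mn}\frac{\partial^3\Phi}{\partial u^i\partial u^k\partial u^m}\frac{\partial^3\Phi}{\partial u^n\partial u^j\partial u^l},\qquad 1\le i,j,k,l\le N.$$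
   Context: The bracket is $\{I,J\}=\int\frac{\delta I}{\delta u^i(x)}\eta^{ij}\frac{d}{dx}\frac{\delta J}{\delta u^j(x)}dx$ on functionals of the fields $u^i(x)$, with summation over repeated upper/lower indices from $1$ to $N$. All considerations are local in $u$; a functional vanishes exactly when its density is a total $x$-derivative (so $\int A_k(u)u^k_x\,dx=0$ iff locally $A_k=\partial S/\partial u^k$ for some function $S(u)$). *)

(* Defs.v *)
From mathcomp Require Import all_boot all_order all_algebra.
From mathcomp Require Import all_classical all_reals all_analysis.

Set Implicit Arguments.
Unset Strict Implicit.
Unset Printing Implicit Defensive.

Import Order.TTheory GRing.Theory Num.Theory.
Import numFieldNormedType.Exports.

Local Open Scope classical_set_scope.
Local Open Scope ring_scope.

(* Stated for matrices because it is used both for the fields u : 'rV_N and for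
   jets of finite order, which are matrices whose row k is the k-th
   x-derivative of u. *)
Definition mx_partial (R : realType) (p q : nat) (a : 'I_p * 'I_q)
    (f : 'M[R]_(p, q) -> R) : 'M[R]_(p, q) -> R :=
  fun x => 'D_(delta_mx a.1 a.2) f x.

(* C^oo on U: all iterated partial derivatives exist and are Frechet
   differentiable (hence continuous) at every point of U. *)
Definition smooth_on (R : realType) (p q : nat) (U : set 'M[R]_(p, q))
    (f : 'M[R]_(p, q) -> R) : Prop :=
  forall (s : seq ('I_p * 'I_q)) (x : 'M[R]_(p, q)),
    U x -> differentiable (foldr (@mx_partial R p q) f s) x.

Definition partial (R : realType) (N : nat) (i : 'I_N) (f : 'rV[R]_N -> R) :
  'rV[R]_N -> R := mx_partial (ord0, i) f.

(* The jet (u, u_x, u_xx, ...): the coordinate u^i_(k) of j is j k 0 i. *)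
Definition jet (R : realType) (N : nat) : Type := nat -> 'rV[R]_N.

Definition jet_shift (R : realType) (N : nat) (k : nat) (i : 'I_N) (t : R)
    (j : jet R N) : jet R N :=
  fun l => if l == k then j l + t *: delta_mx ord0 i else j l.

(* d f / d u^i_(k) *)
Definition jet_partial (R : realType) (N : nat) (k : nat) (i : 'I_N)
    (f : jet R N -> R) : jet R N -> R :=
  fun j => derive1 (fun t : R => f (jet_shift k i t j)) 0.

(* f is a smooth function of (u, u_x, ..., u_(d)) for some d, defined for u in V
   and arbitrary values of the derivatives of u. *)
Definition diff_function (R : realType) (N : nat) (V : set 'rV[R]_N)
    (f : jet R N -> R) : Prop :=
  exists (d : nat) (F : 'M[R]_(d.+1, N) -> R),
    smooth_on [set M | V (row ord0 M)] F /\
    forall j : jet R N, V (j 0%N) -> f j = F (\matrix_(k < d.+1) j k).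

(* The sums over k : nat below have finite support at every jet as soon as f
   depends on finitely many derivatives of u. *)

(* d/dx = \sum_(k, i) u^i_(k+1) d/du^i_(k) *)
Definition total_deriv (R : realType) (N : nat) (f : jet R N -> R) :
    jet R N -> R :=
  fun j => \sum_(k \in [set: nat])
             \sum_(i < N) j k.+1 ord0 i * jet_partial k i f j.

(* delta I / delta u^i = \sum_k (- d/dx)^k (d f / d u^i_(k))
   for the functional I with density f *)
Definition var_deriv (R : realType) (N : nat) (i : 'I_N) (f : jet R N -> R) :
    jet R N -> R :=
  fun j => \sum_(k \in [set: nat])
             (-1) ^+ k * iter k (@total_deriv R N) (jet_partial k i f) j.

(* A functional is represented by a density; two densities represent the same
   functional when their difference is locally in u a total x-derivative. *)
Definition functional_eq0 (R : realType) (N : nat) (U : set 'rV[R]_N)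
    (f : jet R N -> R) : Prop :=
  forall u, U u -> exists V : set 'rV[R]_N,
    [/\ open V, V u, V `<=` U &
      exists S : jet R N -> R, diff_function V S /\
        forall j : jet R N, V (j 0%N) -> f j = total_deriv S j].

(* Density of {I, J} for I, J with densities f, g. *)
Definition bracket (R : realType) (N : nat) (eta : 'M[R]_N)
    (f g : jet R N -> R) : jet R N -> R :=
  fun j => \sum_(a < N) \sum_(b < N)
             var_deriv a f j * eta a b * total_deriv (var_deriv b g) j.

(* Density of I_n. *)
Definition integral_density (R : realType) (N : nat) (Phi : 'rV[R]_N -> R)
    (n : 'I_N) : jet R N -> R :=
  fun j => partial n Phi (j 0%N).

Definition in_involution (R : realType) (N : nat) (eta : 'M[R]_N)
    (U : set 'rV[R]_N) (I : 'I_N -> jet R N -> R) : Prop :=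
  forall n m : 'I_N, functional_eq0 U (bracket eta (I n) (I m)).

Definition partial3 (R : realType) (N : nat) (Phi : 'rV[R]_N -> R)
    (i j k : 'I_N) : 'rV[R]_N -> R :=
  partial i (partial j (partial k Phi)).

Definition associativity_eqs (R : realType) (N : nat) (eta : 'M[R]_N)
    (U : set 'rV[R]_N) (Phi : 'rV[R]_N -> R) : Prop :=
  forall u, U u -> forall i j k l : 'I_N,
    \sum_(m < N) \sum_(n < N)
      eta m n * partial3 Phi i j m u * partial3 Phi n k l u =
    \sum_(m < N) \sum_(n < N)
      eta m n * partial3 Phi i k m u * partial3 Phi n j l u.

(* Main.v *)
(* Since I_n has a density depending on u alone, {I_n, I_m} has the density
   A_k(u) u^k_x with A_k = eta^{ab} Phi_{an} Phi_{kbm}. In d_l A_k - d_k A_l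
   the fourth derivatives of Phi cancel, and what remains is the difference of
   the two sides of the associativity equation with indices (n, l, k, m). So
   associativity says that every form A_k du^k is closed, and it remains to see
   that A_k u^k_x is locally a total derivative iff this form is closed. If it
   is d/dx of a function F(u, u_x, ...) of jets, comparing the terms linear in
   u_x at u_x = u_xx = ... = 0 gives A_k(u) = (dF/du^k)(u, 0, 0, ...), and mixed
   partial derivatives of F commute; the converse is the Poincare lemma. *)
Require Import Defs.
From HB Require Import structures.
From mathcomp Require Import all_boot all_order all_algebra.
From mathcomp Require Import all_classical all_reals all_analysis.
From mathcomp Require Import ring lra.

Import Order.TTheory GRing.Theory Num.Theory.
Import numFieldNormedType.Exports.

Set Implicit Arguments.
Unset Strict Implicit.
Unset Printing Implicit Defensive.

Local Open Scope classical_set_scope.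
Local Open Scope ring_scope.

(** * Differentiability from quadratic bounds, and derivatives along lines *)

(** The bound at [y = x] forces [f x = 0], and elsewhere it makes [f] negligible against [y - x], so
    the zero map is the differential. *)
Lemma quadratic_diff0 (R : realType) (V W : normedModType R) (f : V -> W)
    (x : V) (C : R) :
  (\forall y \near x, `|f y| <= C * `|y - x| ^+ 2) ->
  differentiable f x /\ 'd f x = 0 :> (V -> W).
Proof.
move=> fC.
have fx0 : f x = 0.
  have := nbhs_singleton fC.
  by rewrite subrr normr0 expr0n mulr0 normr_le0 => /eqP.
pose L : {linear V -> W} := \0.
have cL : continuous L by move=> y; exact: cvg_cst.
have fo : f \o shift x = cst (f x) + L +o_ 0 id.
  apply/eqaddoP => e e0.
  have fC' : \forall h \near (0 : V), `|f (h + x)| <= C * `|h| ^+ 2.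
    move: fC; rewrite (near_shift 0 x); apply: filterS => h /=.
    by rewrite subr0 addrK.
  (* Below this radius [C] times the norm of [h] is at most [e], whatever the sign of [C]; the added
     1 keeps the denominator positive. *)
  have Ce : 0 < e / (`|C| + 1) by rewrite divr_gt0// ltr_wpDl.
  near=> h.
  have hC : `|f (h + x)| <= C * `|h| ^+ 2 by near: h.
  have hs : `|h| < e / (`|C| + 1).
    by near: h; apply: nbhs0_lt.
  rewrite [X in `|X|](_ : _ = f (h + x)); last first.
    by rewrite /= !fctE fx0 /= addr0 subr0.
  apply: (le_trans hC); rewrite expr2 mulrA ler_wpM2r//.
  move: hs; rewrite ltr_pdivlMr ?ltr_wpDl// => /ltW; apply: le_trans.
  by rewrite mulrC ler_wpM2l// (le_trans (ler_norm _))// lerDl.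
have dE : 'd f x = L :> (V -> W) by exact: diff_unique cL fo.
by split; [apply/diff_locallyP; rewrite dE|rewrite dE].
Unshelve. all: by end_near. Qed.

(** The difference [g - f] vanishes near [x], hence satisfies a quadratic bound with constant 0. *)
Lemma near_eq_differentiable (R : realType) (V W : normedModType R)
    (f g : V -> W) (x : V) :
  (\forall y \near x, f y = g y) -> differentiable f x -> differentiable g x.
Proof.
move=> fg df; rewrite (_ : g = f + (g - f)); last by rewrite addrC subrK.
apply: differentiableD => //.
apply: (@quadratic_diff0 _ _ _ _ _ 0 _).1; apply: filterS fg => y fgy.
by rewrite mul0r !fctE fgy subrr normr0.
Qed.

Lemma derive_mx_partial (R : realType) (p q : nat) (f : 'M[R]_(p, q) -> R)
    (x v : 'M[R]_(p, q)) : differentiable f x ->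
  'D_v f x = \sum_a v a.1 a.2 * mx_partial a f x.
Proof.
move=> df; rewrite deriveE// [in LHS](matrix_sum_delta v) linear_sum.
rewrite (eq_bigr (fun i => \sum_j v i j * mx_partial (i, j) f x)); last first.
  move=> i _; rewrite linear_sum; apply: eq_bigr => j _.
  by rewrite linearZ /mx_partial deriveE.
by rewrite pair_bigA.
Qed.

Lemma is_derive_line (R : realType) (V W : normedModType R) (f : V -> W)
    (x v : V) (t : R) : derivable f (x + t *: v) v ->
  is_derive t 1 (fun s => f (x + s *: v)) ('D_v f (x + t *: v)).
Proof.
move=> df.
have eq_quot : (fun h => h^-1 *: (((fun s => f (x + s *: v)) \o shift t) (h *: 1)
    - f (x + t *: v))) =
    (fun h => h^-1 *: ((f \o shift (x + t *: v)) (h *: v) - f (x + t *: v))).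
  apply/funext => h /=; congr (_ *: (f _ - _)).
  by rewrite [h *: 1]mulr1 scalerDl addrCA.
by split; [rewrite /derivable eq_quot|rewrite /derive eq_quot].
Qed.

Lemma MVT_line (R : realType) (V : normedModType R) (f : V -> R) (x v : V) :
  (forall t : R, 0 <= t <= 1 -> differentiable f (x + t *: v)) ->
  exists2 t : R, 0 < t < 1 & f (x + v) - f x = 'D_v f (x + t *: v).
Proof.
move=> df.
have id (t : R) : t \in `[0, 1]%R ->
    is_derive t 1 (fun s => f (x + s *: v)) ('D_v f (x + t *: v)).
  by rewrite in_itv /= => t01; exact/is_derive_line/diff_derivable/df.
pose phi (t : R) := f (x + t *: v).
have phi_cont : {within `[0, 1], continuous phi}.
  by apply: derivable_within_continuous => t t01; have [] := id t t01.
have id' (t : R) : t \in `]0, 1[%R -> is_derive t 1 phi ('D_v f (x + t *: v)).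
  move=> t01; apply: id; move: t01.
  by rewrite !in_itv /= => /andP[/ltW -> /ltW ->].
have [t t01] := MVT ltr01 id' phi_cont.
rewrite /phi scale1r scale0r addr0 subr0 mulr1 => ->.
by exists t => //; move: t01; rewrite in_itv.
Qed.

(** * Closure properties of smooth functions *)

Lemma smooth_on_differentiable (R : realType) (p q : nat)
    (U : set 'M[R]_(p, q)) (f : 'M[R]_(p, q) -> R) (x : 'M[R]_(p, q)) :
  smooth_on U f -> U x -> differentiable f x.
Proof. by move=> /(_ [::] x). Qed.

Lemma smooth_on_mx_partial (R : realType) (p q : nat) (a : 'I_p * 'I_q)
    (U : set 'M[R]_(p, q)) (f : 'M[R]_(p, q) -> R) :
  smooth_on U f -> smooth_on U (mx_partial a f).
Proof.
by move=> fs s x Ux; have := fs (rcons s a) x Ux; rewrite foldr_rcons.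
Qed.

Lemma smooth_on_subset (R : realType) (p q : nat) (U V : set 'M[R]_(p, q))
    (f : 'M[R]_(p, q) -> R) : V `<=` U -> smooth_on U f -> smooth_on V f.
Proof. by move=> VU fs s x /VU Ux; exact: fs. Qed.

(** A coinduction principle: a class of differentiable functions that is stable under partial
    derivatives, up to equality on [U], consists of smooth functions. It spares any explicit formula
    for iterated derivatives. *)
Lemma smooth_on_coind (R : realType) (p q : nat) (U : set 'M[R]_(p, q))
    (P : ('M[R]_(p, q) -> R) -> Prop) : open U ->
  (forall f x, P f -> U x -> differentiable f x) ->
  (forall f a, P f -> exists2 g, P g & {in U, mx_partial a f =1 g}) ->
  forall f, P f -> smooth_on U f.
Proof.
move=> Uo Pd Pp f Pf s.
have nearU (g h : 'M[R]_(p, q) -> R) x : {in U, g =1 h} -> U x ->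
    \forall y \near x, g y = h y.
  move=> gh Ux; near=> y; apply: gh; rewrite inE; near: y.
  exact: open_nbhs_nbhs.
(* Stability holds only on [U], so the induction must carry functions that merely agree with a
   member of [P] there. It peels off the innermost derivative, the last entry of [s]. *)
suff gen g : {in U, g =1 f} ->
    forall x, U x -> differentiable (foldr (@mx_partial R p q) g s) x.
  exact: gen.
elim/last_ind: s f Pf g => [|s a IH] f Pf g gf x Ux /=.
  by apply: near_eq_differentiable (Pd f x Pf Ux); apply: nearU => // y /gf.
rewrite foldr_rcons.
have [h Ph fh] := Pp f a Pf.
apply: (IH h Ph (mx_partial a g)) => // y yU; rewrite -fh//.
by apply: near_eq_derive; apply: nearU => //; rewrite inE in yU.
Unshelve. all: by end_near. Qed.

(** The Leibniz rule turns a product into a sum of products, so products alone are not a stable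
    class. The algebra generated by smooth functions is stable, as [smooth_on_coind] requires. *)
Inductive smooth_alg (R : realType) (p q : nat) (U : set 'M[R]_(p, q)) :
    ('M[R]_(p, q) -> R) -> Prop :=
| SmoothAlgBase f : smooth_on U f -> smooth_alg U f
| SmoothAlgCst c : smooth_alg U (cst c)
| SmoothAlgAdd f g : smooth_alg U f -> smooth_alg U g -> smooth_alg U (f + g)
| SmoothAlgMul f g : smooth_alg U f -> smooth_alg U g -> smooth_alg U (f * g).

Lemma smooth_alg_on (R : realType) (p q : nat) (U : set 'M[R]_(p, q))
    (f : 'M[R]_(p, q) -> R) : open U -> smooth_alg U f -> smooth_on U f.
Proof.
move=> Uo; have dif g x : smooth_alg U g -> U x -> differentiable g x.
  move=> + Ux; elim=> {g} [g gs|c|g h _ dg _ dh|g h _ dg _ dh].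
  - exact: smooth_on_differentiable gs Ux.
  - exact: differentiable_cst.
  - exact: differentiableD.
  - exact: differentiableM.
apply: smooth_on_coind => // g a.
elim=> {g} [g gs|c|g h sg IHg sh IHh|g h sg IHg sh IHh].
- by exists (mx_partial a g) => //; exact/SmoothAlgBase/smooth_on_mx_partial.
- exists (cst 0); first exact: SmoothAlgCst.
  by move=> x _; rewrite /mx_partial derive_cst.
- have [[g' sg' gg'] [h' sh' hh']] := (IHg, IHh).
  exists (g' + h'); first exact: SmoothAlgAdd.
  move=> x xU; have Ux : U x by rewrite inE in xU.
  rewrite /mx_partial deriveD; [|exact/diff_derivable/dif..].
  by rewrite fctE -gg'// -hh'.
- have [[g' sg' gg'] [h' sh' hh']] := (IHg, IHh).
  exists (g * h' + h * g').
    by apply: SmoothAlgAdd; apply: SmoothAlgMul.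
  move=> x xU; have Ux : U x by rewrite inE in xU.
  rewrite /mx_partial deriveM; [|exact/diff_derivable/dif..].
  by rewrite !fctE -gg'// -hh'.
Qed.

Lemma smooth_on_cst (R : realType) (p q : nat) (U : set 'M[R]_(p, q)) (c : R) :
  open U -> smooth_on U (fun=> c).
Proof. by move=> Uo; apply: smooth_alg_on => //; exact: SmoothAlgCst. Qed.

Lemma smooth_onM (R : realType) (p q : nat) (U : set 'M[R]_(p, q))
    (f g : 'M[R]_(p, q) -> R) : open U -> smooth_on U f -> smooth_on U g ->
  smooth_on U (fun x => f x * g x).
Proof.
move=> Uo fs gs; apply: smooth_alg_on => //.
by apply: (@SmoothAlgMul _ _ _ _ f g); exact: SmoothAlgBase.
Qed.

Lemma smooth_on_sum (R : realType) (p q n : nat) (U : set 'M[R]_(p, q))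
    (F : 'I_n -> 'M[R]_(p, q) -> R) : open U -> (forall i, smooth_on U (F i)) ->
  smooth_on U (fun x => \sum_i F i x).
Proof.
move=> Uo Fs; apply: smooth_alg_on => //.
rewrite (_ : (fun _ => _) = \sum_i F i); last first.
  by apply/funext => x; rewrite fct_sumE.
elim/big_ind : _ => [|f g|i _]; [exact: SmoothAlgCst|exact: SmoothAlgAdd|].
exact: SmoothAlgBase.
Qed.

(** * Symmetry of mixed partial derivatives *)

(* Two applications of the mean value theorem to the second difference
   f(x+hv+hw) - f(x+hv) - f(x+hw) + f(x). *)
Lemma second_difference (R : realType) (V : normedModType R) (f : V -> R)
    (x v w : V) :
  (forall s t : R, 0 <= s <= 1 -> 0 <= t <= 1 ->
    differentiable f (x + s *: v + t *: w)) ->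
  (forall s t : R, 0 <= s <= 1 -> 0 <= t <= 1 ->
    differentiable (fun y => 'D_v f y) (x + s *: v + t *: w)) ->
  exists s t : R, [/\ 0 <= s <= 1, 0 <= t <= 1 &
    f (x + v + w) - f (x + v) - f (x + w) + f x =
    'D_w (fun y => 'D_v f y) (x + s *: v + t *: w)].
Proof.
move=> df ddf.
have d0 (s : R) : 0 <= s <= 1 -> differentiable f (x + s *: v).
  move=> s01; have := df s 0 s01.
  by rewrite scale0r addr0; apply; rewrite lexx ler01.
have d1 (s : R) : 0 <= s <= 1 -> differentiable f (x + s *: v + w).
  by move=> s01; have := df s 1 s01; rewrite scale1r; apply; rewrite lexx ler01.
pose g := fun y => f (y + w) - f y.
have dsh (s : R) : 0 <= s <= 1 ->
    differentiable (fun y => f (y + w)) (x + s *: v).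
  move=> s01; apply: (@differentiable_comp _ _ _ _ (fun y => y + w) f) => //.
  exact: d1.
have [s s01] : exists2 s : R, 0 < s < 1 & g (x + v) - g x = 'D_v g (x + s *: v).
  apply: MVT_line => s s01; apply: differentiableB; [exact: dsh|exact: d0].
have s01' : 0 <= s <= 1 by case/andP: s01 => /ltW -> /ltW ->.
rewrite /g deriveB; [|exact/diff_derivable/dsh|exact/diff_derivable/d0].
have -> : 'D_v (fun y => f (y + w)) (x + s *: v) = 'D_v f (x + s *: v + w).
  rewrite /derive; congr (lim _); apply: (congr1 (fun k => k @ 0^')).
  by apply/funext => h /=; rewrite !addrA.
have [t t01 ->] := @MVT_line R V (fun y => 'D_v f y) (x + s *: v) w
  (fun t => ddf s t s01').
have t01' : 0 <= t <= 1 by case/andP: t01 => /ltW -> /ltW ->.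
by move=> E; exists s, t; split=> //; rewrite -E; ring.
Qed.

Lemma derive_dirZ (R : realType) (V W : normedModType R) (f : V -> W)
    (x v : V) (h : R) : differentiable f x -> 'D_(h *: v) f x = h *: 'D_v f x.
Proof. by move=> df; rewrite !deriveE// linearZ. Qed.

Lemma mx_partialC (R : realType) (p q : nat) (U : set 'M[R]_(p, q))
    (f : 'M[R]_(p, q) -> R) (a b : 'I_p * 'I_q) (x : 'M[R]_(p, q)) :
  open U -> smooth_on U f -> U x ->
  mx_partial a (mx_partial b f) x = mx_partial b (mx_partial a f) x.
Proof.
move=> Uo fs Ux.
wlog suff half : a b / forall e : R, 0 < e -> exists2 d : R, 0 < d &
    forall h : R, 0 < h < d -> let v := h *: delta_mx a.1 a.2 in
    let w := h *: delta_mx b.1 b.2 in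
    `|f (x + v + w) - f (x + v) - f (x + w) + f x -
       h ^+ 2 * mx_partial b (mx_partial a f) x| <= h ^+ 2 * e.
  apply/eqP; rewrite -subr_eq0 -normr_le0; apply/ler_addgt0Pl => e e0.
  rewrite addr0.
  have e20 : 0 < e / 2 by rewrite divr_gt0.
  have [d1 d10 H1] := half a b _ e20.
  have [d2 d20 H2] := half b a _ e20.
  pose h := Num.min d1 d2 / 2.
  have m0 : 0 < Num.min d1 d2 by rewrite lt_min d10.
  have h0 : 0 < h by rewrite divr_gt0.
  have hm : h < Num.min d1 d2 by rewrite /h ltr_pdivrMr// ltr_pMr// ltr1n.
  have := H1 h; have := H2 h; rewrite h0.
  move: hm; rewrite lt_min => /andP[-> ->] /(_ isT) /= A /(_ isT) /= B.
  rewrite -(@ler_pM2l _ (h ^+ 2)) ?exprn_gt0//.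
  rewrite -[X in X * `|_|](@ger0_norm _ (h ^+ 2)) ?exprn_ge0 ?(ltW h0)//.
  rewrite -normrM [e]splitr [leRHS]mulrDr.
  move: (lerD B A); apply: le_trans; rewrite -[X in _ <= _ + X]normrN.
  apply: le_trans (ler_normD _ _).
  rewrite le_eqVlt; apply/orP; left; apply/eqP; congr (`|_|).
  rewrite (addrAC x (h *: delta_mx b.1 b.2)).
  move: (f (x + _ + _)) (f (x + _)) (f (x + _)) (f x) => f1 f2 f3 f4.
  move: (mx_partial _ _ x) (mx_partial _ _ x) => P1 P2.
  by ring.
move=> e e0.
pose g := mx_partial b (mx_partial a f).
have gs : smooth_on U g by do 2! apply: smooth_on_mx_partial.
have gc : {for x, continuous g}.
  exact/differentiable_continuous/(smooth_on_differentiable gs Ux).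
have /nbhs_ballP[r /= r0 xr] : \forall y \near x, U y /\ `|g x - g y| <= e.
  near=> y; split; near: y; first exact: open_nbhs_nbhs.
  by have /cvgrPdist_le := gc; apply.
pose D := `|delta_mx a.1 a.2 : 'M[R]_(p, q)| + `|delta_mx b.1 b.2 : 'M[R]_(p, q)|.
have D0 : 0 <= D by rewrite addr_ge0.
(* The norms of [v] and [w] add up to [h * D], so below this bound the whole parallelogram spanned
   at [x] stays in the ball of radius [r]. *)
exists (r / (D + 1)); first by rewrite divr_gt0// ltr_wpDl.
move=> h /andP[h0]; rewrite ltr_pdivlMr ?ltr_wpDl// => hD.
pose v := h *: delta_mx a.1 a.2 : 'M[R]_(p, q).
pose w := h *: delta_mx b.1 b.2 : 'M[R]_(p, q).
rewrite -/v -/w.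
have near_x (s t : R) : 0 <= s <= 1 -> 0 <= t <= 1 ->
    U (x + s *: v + t *: w) /\ `|g x - g (x + s *: v + t *: w)| <= e.
  move=> /andP[s0 s1] /andP[t0 t1]; apply: xr; rewrite -ball_normE /=.
  rewrite -addrA opprD addNKr normrN; apply: le_lt_trans hD.
  rewrite (le_trans (ler_normD _ _))// !normrZ !ger0_norm ?(ltW h0)//.
  rewrite mulrDr mulr1 mulrDr; apply: ler_wpDr; first exact: ltW.
  by rewrite lerD// !mulrA ler_wpM2r// ler_piMl// ltW.
have as_ := smooth_on_mx_partial a fs.
have dvE y : U y -> 'D_v f y = h * mx_partial a f y.
  by move=> Uy; rewrite derive_dirZ//; exact: smooth_on_differentiable fs Uy.
have dvEn y : U y -> \forall z \near y, h * mx_partial a f z = 'D_v f z.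
  by move=> Uy; near=> z; rewrite dvE//; near: z; exact: open_nbhs_nbhs.
have [||s [t [s01 t01 ->]]] := @second_difference R _ f x v w.
- by move=> s t s01 t01; apply: smooth_on_differentiable fs (near_x s t s01 t01).1.
- move=> s t s01 t01; have [Uy _] := near_x s t s01 t01.
  apply: near_eq_differentiable (dvEn _ Uy) _.
  exact: differentiableZ (smooth_on_differentiable as_ Uy).
have [Uy ge] := near_x s t s01 t01.
have day := smooth_on_differentiable as_ Uy.
rewrite -(near_eq_derive _ (dvEn _ Uy)).
rewrite deriveZ; last exact: diff_derivable.
rewrite derive_dirZ// -[mx_partial b (mx_partial a f) x]/(g x).
rewrite -[X in `|h *: (h *: X) - _|]/(g (x + s *: v + t *: w)).
rewrite [h *: (h *: _)]mulrA -expr2 -mulrBr normrM distrC.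
by rewrite ger0_norm ?exprn_ge0 ?(ltW h0)// ler_wpM2l// exprn_ge0 ?(ltW h0).
Unshelve. all: by end_near. Qed.

(** * Local estimates uniform in both endpoints *)

Lemma ler_mx_norm_coord (R : realType) (p q : nat) (v : 'M[R]_(p, q))
    (i : 'I_p) (j : 'I_q) : `|v i j| <= `|v|.
Proof.
have /mapP[ij _ ->] : `|v i j| \in [seq `|v x.1 x.2| | x : 'I_p * 'I_q].
  by apply/mapP; exists (i, j) => //=; rewrite mem_enum.
rewrite [leRHS]/Num.Def.normr /= mx_normrE.
by apply/bigmax_geP; right => /=; exists ij.
Qed.

Lemma ball_segment (R : realType) (V : normedModType R) (u x y : V) (r t : R) :
  ball u r x -> ball u r y -> 0 <= t <= 1 -> ball u r (x + t *: (y - x)).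
Proof.
rewrite -!ball_normE /= => xr yr /andP[t0 t1].
have -> : u - (x + t *: (y - x)) = (1 - t) *: (u - x) + t *: (u - y).
  rewrite scalerBl scale1r -addrA [- _ + _]addrC -scalerBr opprB.
  by rewrite [u - y + _]addrC subrKA opprD addrA -scalerN opprB.
rewrite (le_lt_trans (ler_normD _ _))// !normrZ !ger0_norm ?subr_ge0//.
(* The strict inequality is taken from the [y] term, which has weight [t]; at [t = 0] it must come
   from [x]. *)
have [->|tn0] := eqVneq t 0.
  by rewrite mul0r addr0 subr0 mul1r.
have tp : 0 < t by rewrite lt_def tn0.
rewrite [ltRHS](_ : r = (1 - t) * r + t * r); last by ring.
by rewrite ler_ltD ?ltr_pM2l// ler_wpM2l ?subr_ge0// ltW.
Qed.

(** Finiteness of [I] gives both a common neighbourhood and a common constant, the sum of the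
    absolute values of the individual ones. *)
Lemma near_uniform_bound (R : realType) (I : finType) (T : Type)
    (F : set_system T) {FF : Filter F} (g : I -> T -> R) (b : T -> R) :
  (forall z, 0 <= b z) ->
  (forall i, exists K : R, \forall z \near F, g i z <= K * b z) ->
  exists2 K : R, 0 <= K & \forall z \near F, forall i, g i z <= K * b z.
Proof.
move=> b0 /choice[K gK]; exists (\sum_i `|K i|); first exact: sumr_ge0.
have := @filter_forall T I (fun i z => g i z <= K i * b z) F FF gK.
apply: (@filterS T F FF) => z H i.
apply: (le_trans (H i)); rewrite ler_wpM2r//.
rewrite (bigD1 i)//= (le_trans (ler_norm _))// lerDl.
exact: sumr_ge0.
Qed.

(** Near [u] each partial derivative exceeds its size at [u] by at most 1, and the mean value
    theorem on a segment does the rest. The filter at [(u, u)] lets both endpoints move. *)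
Lemma smooth_on_lipschitz (R : realType) (p q : nat) (U : set 'M[R]_(p, q))
    (f : 'M[R]_(p, q) -> R) (u : 'M[R]_(p, q)) :
  open U -> smooth_on U f -> U u ->
  exists K : R, \forall z \near (u, u), `|f z.2 - f z.1| <= K * `|z.2 - z.1|.
Proof.
move=> Uo fs Uu.
have /nbhs_ballP[r /= r0 ur] : \forall y \near u,
    U y /\ forall a, `|mx_partial a f y| <= `|mx_partial a f u| + 1.
  near=> y; split; first by near: y; exact: open_nbhs_nbhs.
  near: y; apply: filter_forall => a.
  have ac : {for u, continuous (mx_partial a f)}.
    apply: differentiable_continuous.
    exact: smooth_on_differentiable (smooth_on_mx_partial a fs) Uu.
  move/cvgrPdist_le : ac => /(_ 1 ltr01); apply: filterS => y.
  rewrite distrC => yu; rewrite -[mx_partial a f y](subrK (mx_partial a f u)).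
  by rewrite (le_trans (ler_normD _ _))// addrC lerD2l.
exists (\sum_a (`|mx_partial a f u| + 1)).
apply/nbhs_ballP; exists r => //= -[x y] [/= xr yr].
have Ut (t : R) : 0 <= t <= 1 -> ball u r (x + t *: (y - x)).
  exact: ball_segment.
have [|t t01] := @MVT_line R _ f x (y - x).
  by move=> t /Ut /ur[Ut' _]; exact: smooth_on_differentiable fs Ut'.
rewrite [x + (y - x)]addrC subrK => ->.
have /Ut/ur[Ut' bnd] : 0 <= t <= 1 by case/andP: t01 => /ltW -> /ltW ->.
rewrite derive_mx_partial; last exact: smooth_on_differentiable fs Ut'.
rewrite (le_trans (ler_norm_sum _ _ _))// mulr_suml ler_sum// => a _.
by rewrite normrM mulrC ler_pM ?normr_ge0 ?bnd ?ler_mx_norm_coord.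
Unshelve. all: by end_near. Qed.

(** The mean value theorem replaces the increment by a derivative at an intermediate point, and the
    Lipschitz bound on the partial derivatives supplies the second factor of the distance. *)
Lemma smooth_on_taylor (R : realType) (p q : nat) (U : set 'M[R]_(p, q))
    (f : 'M[R]_(p, q) -> R) (u : 'M[R]_(p, q)) :
  open U -> smooth_on U f -> U u ->
  exists K : R, \forall z \near (u, u),
    `|f z.2 - f z.1 - \sum_a (z.2 - z.1) a.1 a.2 * mx_partial a f z.1|
      <= K * `|z.2 - z.1| ^+ 2.
Proof.
move=> Uo fs Uu.
have [K K0 Klip] := @near_uniform_bound R ('I_p * 'I_q)%type _ (nbhs (u, u)) _
  (fun a z => `|mx_partial a f z.2 - mx_partial a f z.1|)
  (fun z => `|z.2 - z.1|) (fun z => normr_ge0 _)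
  (fun a => smooth_on_lipschitz Uo (smooth_on_mx_partial a fs) Uu).
have /nbhs_ballP[r /= r0 ur] : \forall z \near (u, u), U z.1 /\
    forall a, `|mx_partial a f z.2 - mx_partial a f z.1| <= K * `|z.2 - z.1|.
  near=> z; split; last by near: z.
  by near: z; apply: (@cvg_fst _ _ (nbhs u) (nbhs u)); exact: open_nbhs_nbhs.
exists (\sum_(a : 'I_p * 'I_q) K).
apply/nbhs_ballP; exists r => //= -[x y] [/= xr yr].
have Ut (t : R) : 0 <= t <= 1 -> ball u r (x + t *: (y - x)).
  exact: ball_segment.
have [|t t01] := @MVT_line R _ f x (y - x).
  move=> t /Ut Ut'; apply: (smooth_on_differentiable fs).
  by have [] := ur (_, u) (conj Ut' (ballxx u r0)).
rewrite [x + (y - x)]addrC subrK => ->.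
have t01' : 0 <= t <= 1 by case/andP: t01 => /ltW -> /ltW ->.
have Ut' := Ut t t01'.
rewrite derive_mx_partial; last first.
  apply: (smooth_on_differentiable fs).
  by have [] := ur (_, u) (conj Ut' (ballxx u r0)).
rewrite -sumrB (le_trans (ler_norm_sum _ _ _))// mulr_suml ler_sum// => a _.
rewrite -mulrBr normrM mulrC expr2 mulrA ler_pM ?normr_ge0 ?ler_mx_norm_coord//.
have [_ /(_ a) /= bnd] := ur (x, x + t *: (y - x)) (conj xr Ut').
apply: (le_trans bnd); rewrite ler_wpM2l// addrAC subrr add0r normrZ.
by case/andP: t01' => t0 t1; rewrite ger0_norm// ler_piMl.
Unshelve. all: by end_near. Qed.

(** * Primitives of closed 1-forms *)

(** The primitive is the Lebesgue integral from [a]. Continuity on the closed interval and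
    derivatives on the open one are what the mean value theorem asks for. *)
Lemma continuous_primitive (R : realType) (g : R -> R) (a b : R) : a < b ->
  (forall t, a <= t <= b -> {for t, continuous g}) ->
  exists P : R -> R, [/\ {within `[a, b], continuous P}, P a = 0 &
    forall t, a < t < b -> is_derive t 1 P (g t)].
Proof.
move=> ab gc; pose mu := @lebesgue_measure R.
have gi : mu.-integrable `[a, b] (EFin \o g).
  apply: continuous_compact_integrable; first exact: segment_compact.
  by apply: continuous_in_subspaceT => t; rewrite inE /= in_itv /=; exact: gc.
exists (fun t => parameterized_integral mu a t g); split.
- exact: parameterized_integral_continuous (ltW ab) gi.
- by rewrite /parameterized_integral set_itv1 Rintegral_set1.
- move=> t /andP[at_ tb].
  have [|dP dE] := @continuous_FTC1_closed R g a t b tb gi at_.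
    by apply: gc; rewrite !ltW.
  by split; [exact: dP|rewrite -derive1E -dE].
Qed.

Lemma is_derive_fsum (R : realType) (V W : normedModType R) (I : finType)
    (f : I -> V -> W) (df : I -> W) (x v : V) :
  (forall i, is_derive x v (f i) (df i)) ->
  is_derive x v (fun y => \sum_i f i y) (\sum_i df i).
Proof.
move=> fdf; rewrite (_ : (fun _ => _) = \sum_i f i); last first.
  by apply/funext => y; rewrite fct_sumE.
elim/big_ind2 : _ => [|g dg h dh gd hd|i _ //]; first exact: is_derive_cst.
exact: is_deriveD.
Qed.

Lemma quadratic_diff (R : realType) (V W : normedModType R) (f : V -> W)
    (L : {linear V -> W}) (x : V) (C : R) : continuous L ->
  (\forall y \near x, `|f y - f x - L (y - x)| <= C * `|y - x| ^+ 2) ->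
  differentiable f x /\ 'd f x = L :> (V -> W).
Proof.
move=> cL fL; pose T y := f y - (L y + (f x - L x)).
have [] := @quadratic_diff0 _ _ _ T x C.
  apply: filterS fL => y; congr (`|_| <= _).
  by rewrite /T linearB !opprD !opprK !addrA [f y - f x - _]addrAC.
move=> dT T0.
have dL : differentiable (L : V -> W) x by exact: linear_differentiable.
have dc : differentiable (cst (f x - L x)) x by exact: differentiable_cst.
have fE : f = T + ((L : V -> W) + cst (f x - L x)).
  by apply/funext => y; rewrite !fctE /T /= subrK.
split.
  rewrite fE; apply: differentiableD => //; exact: differentiableD.
rewrite [in LHS]fE diffD//; last exact: differentiableD.
apply/funext => v /=; rewrite T0 diffD//= diff_lin// diff_cst.
by rewrite add0r addr0.
Qed.

(** Here [c] is a candidate gradient: a second-order estimate against it identifies the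
    differential, and testing on [delta_mx] reads off the partial derivatives. *)
Lemma quadratic_mx_partial (R : realType) (p q : nat) (f : 'M[R]_(p, q) -> R)
    (c : 'I_p * 'I_q -> R) (x : 'M[R]_(p, q)) (C : R) :
  (\forall y \near x, `|f y - f x - \sum_a (y - x) a.1 a.2 * c a|
    <= C * `|y - x| ^+ 2) ->
  differentiable f x /\ forall a, mx_partial a f x = c a.
Proof.
pose l (v : 'M[R]_(p, q)) := \sum_a v a.1 a.2 * c a.
have l_lin : linear l.
  move=> k v w; rewrite /l scaler_sumr -big_split; apply: eq_bigr => a _ /=.
  by rewrite !mxE mulrDl -mulrA.
pose L : {linear 'M[R]_(p, q) -> R} :=
  HB.pack l (GRing.isLinear.Build _ _ _ _ l l_lin).
have cL : continuous L.
  apply: bounded_linear_continuous; apply/linear_boundedP.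
  near=> k => v; rewrite /= /l (le_trans (ler_norm_sum _ _ _))//.
  apply: (@le_trans _ _ (\sum_a `|c a| * `|v|)).
    by apply: ler_sum => a _; rewrite normrM mulrC ler_wpM2l// ler_mx_norm_coord.
  by rewrite -mulr_suml ler_wpM2r.
move=> /(@quadratic_diff _ _ _ f L x C cL)[df dfE]; split=> // a.
rewrite /mx_partial deriveE// dfE /= /l (bigD1 a)//= mxE !eqxx mul1r.
rewrite big1 ?addr0// => b ba; rewrite mxE -[_ && _]/(b == a).
by rewrite (negbTE ba) mul0r.
Unshelve. all: by end_near. Qed.

(* [S] integrates the form along the segments issued from [u]; comparing the
   two antiderivatives along the segments to [y] and [y'] with the mean value
   theorem avoids differentiating under the integral sign. *)
Lemma poincare (R : realType) (p q : nat) (U : set 'M[R]_(p, q))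
    (A : 'I_p * 'I_q -> 'M[R]_(p, q) -> R) (u : 'M[R]_(p, q)) :
  open U -> (forall a, smooth_on U (A a)) ->
  (forall a b x, U x -> mx_partial a (A b) x = mx_partial b (A a) x) ->
  U u -> exists (V : set 'M[R]_(p, q)) (S : 'M[R]_(p, q) -> R),
    [/\ open V, V u, V `<=` U, smooth_on V S &
      forall a x, V x -> mx_partial a S x = A a x].
Proof.
move=> Uo As Acl Uu.
have [K1 K10 B1] := @near_uniform_bound R ('I_p * 'I_q)%type _ (nbhs (u, u)) _
  (fun a z => `|A a z.2 - A a z.1|) (fun z => `|z.2 - z.1|)
  (fun z => normr_ge0 _) (fun a => smooth_on_lipschitz Uo (As a) Uu).
have [K2 K20 B2] := @near_uniform_bound R ('I_p * 'I_q)%type _ (nbhs (u, u)) _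
  (fun a z => `|A a z.2 - A a z.1 -
     \sum_b (z.2 - z.1) b.1 b.2 * mx_partial b (A a) z.1|)
  (fun z => `|z.2 - z.1| ^+ 2) (fun z => exprn_ge0 _ (normr_ge0 _))
  (fun a => smooth_on_taylor Uo (As a) Uu).
have /nbhs_ballP[r /= r0 ur] : \forall z \near (u, u), [/\ U z.1,
    forall a, `|A a z.2 - A a z.1| <= K1 * `|z.2 - z.1| &
    forall a, `|A a z.2 - A a z.1 -
      \sum_b (z.2 - z.1) b.1 b.2 * mx_partial b (A a) z.1|
      <= K2 * `|z.2 - z.1| ^+ 2].
  near=> z; split; [|by near: z..].
  by near: z; apply: (@cvg_fst _ _ (nbhs u) (nbhs u)); exact: open_nbhs_nbhs.
have {}ur (x y : 'M[R]_(p, q)) : ball u r x -> ball u r y -> [/\ U x,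
    forall a, `|A a y - A a x| <= K1 * `|y - x| &
    forall a, `|A a y - A a x - \sum_b (y - x) b.1 b.2 * mx_partial b (A a) x|
      <= K2 * `|y - x| ^+ 2].
  by move=> xr yr; exact: (ur (x, y) (conj xr yr)).
have uu := ballxx u r0.
have VU : ball u r `<=` U by move=> x xr; have [] := ur x u xr uu.
pose c (y : 'M[R]_(p, q)) (t : R) := u + t *: (y - u).
have cV (y : 'M[R]_(p, q)) (t : R) : ball u r y -> 0 <= t <= 1 -> ball u r (c y t).
  by move=> yr; exact: ball_segment.
have dA a (x : 'M[R]_(p, q)) : ball u r x -> differentiable (A a) x.
  by move=> /VU Ux; exact: smooth_on_differentiable (As a) Ux.
pose g (k y : 'M[R]_(p, q)) (t : R) := \sum_a k a.1 a.2 * A a (c y t).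
pose dg (k y : 'M[R]_(p, q)) (t : R) :=
  \sum_a k a.1 a.2 * 'D_(y - u) (A a) (c y t).
have g_der (k y : 'M[R]_(p, q)) (t : R) : ball u r y -> 0 <= t <= 1 ->
    is_derive t 1 (g k y) (dg k y t).
  move=> yr t01; apply: is_derive_fsum => a.
  apply: (@is_deriveZ _ _ _ (fun t => A a (c y t))).
  exact/is_derive_line/diff_derivable/dA/cV.
have g_cont (k y : 'M[R]_(p, q)) (t : R) : ball u r y -> 0 <= t <= 1 ->
    {for t, continuous (g k y)}.
  move=> yr t01; apply/differentiable_continuous/derivable1_diffP.
  by have [] := g_der k y t yr t01.
have /choice[P PE] : forall y : 'M[R]_(p, q), exists P : R -> R, ball u r y ->
    [/\ {within `[0, 1], continuous P}, P 0 = 0 &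
    forall t : R, 0 < t < 1 -> is_derive t 1 P (g (y - u) y t)].
  (* Outside the ball the zero function is a dummy value, needed only to choose [P] for all [y]. *)
  move=> y; have [yr|yr] := pselect (ball u r y); last by exists (cst 0).
  have [|P HP] := @continuous_primitive R (g (y - u) y) 0 1 ltr01.
    by move=> t; exact: g_cont.
  by exists P.
pose S (y : 'M[R]_(p, q)) := P y 1.
(* For each index, [r] bounds a coordinate of [y - u] multiplying a Taylor remainder ([K2]), and
   [K1] bounds an increment of [A a] multiplying a coordinate of [y' - y]. *)
pose C := \sum_(a : 'I_p * 'I_q) (r * K2 + K1).
have key (y y' : 'M[R]_(p, q)) : ball u r y -> ball u r y' ->
    `|S y' - S y - \sum_a (y' - y) a.1 a.2 * A a y| <= C * `|y' - y| ^+ 2.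
  move=> yr yr'; set h := y' - y.
  have [Pc P0 Pd] := PE y yr; have [Pc' P0' Pd'] := PE y' yr'.
  (* The error restricted to the two segments at time [t]: [E 1 - E 0] is the quantity to bound, and
     the factor [id] reflects that the segments are [t *: h] apart. *)
  pose E : R -> R := P y' - P y - id * g h y.
  pose dE (t : R) := g (y' - u) y' t - g (y - u) y t -
    (t *: dg h y t + g h y t *: 1).
  have E_der (t : R) : t \in `]0, 1[%R -> is_derive t 1 E (dE t).
    rewrite in_itv /= => t01.
    have t01' : 0 <= t <= 1 by case/andP: t01 => /ltW -> /ltW ->.
    have := Pd' t t01; have := Pd t t01; have := g_der h y t yr t01'.
    by move=> gd d d'; exact: is_deriveB.
  have E_cont : {within `[0, 1], continuous E}.
    have gc : {within `[0, 1], continuous (g h y)}.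
      apply: continuous_in_subspaceT => t; rewrite inE /= in_itv /=.
      exact: g_cont.
    move=> t; apply: continuousB.
      by apply: continuousB; [exact: Pc'|exact: Pc].
    apply: continuousM; last exact: gc.
    exact: (continuous_subspaceT (fun x => cvg_id)).
  have [t t01] := MVT ltr01 E_der E_cont.
  rewrite {1 2}/E !fctE P0 P0' mul0r !subr0 mulr1 mul1r.
  rewrite {1}/g {1}/c scale1r [u + (y - u)]addrC subrK => ->.
  have {}t01 : 0 <= t <= 1.
    by move: t01; rewrite in_itv /= => /andP[/ltW -> /ltW ->].
  have [cr cr'] := (cV y t yr t01, cV y' t yr' t01).
  have [_ b1 b2] := ur _ _ cr cr'.
  have cc : c y' t - c y t = t *: h.
    by rewrite /c opprD addrACA subrr add0r -scalerBr opprB addrA subrK.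
  have -> : dE t = \sum_a ((y - u) a.1 a.2 * (A a (c y' t) - A a (c y t) -
      \sum_b (c y' t - c y t) b.1 b.2 * mx_partial b (A a) (c y t)) +
      h a.1 a.2 * (A a (c y' t) - A a (c y t))).
    (* Closedness enters here: exchanging the two indices turns derivatives along [y - u] into
       derivatives along [t *: h], which are the linear Taylor terms. *)
    have dgE : t * dg h y t = \sum_a (y - u) a.1 a.2 *
        \sum_b (c y' t - c y t) b.1 b.2 * mx_partial b (A a) (c y t).
      rewrite /dg mulr_sumr.
      under [RHS]eq_bigr do rewrite mulr_sumr.
      rewrite [RHS]exchange_big; apply: eq_bigr => a _ /=.
      rewrite derive_mx_partial; last exact: dA.
      rewrite !mulr_sumr; apply: eq_bigr => b _.
      rewrite (Acl b a); last exact: VU.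
      by rewrite cc [(t *: h) _ _]mxE; ring.
    rewrite /dE [t *: _]dgE [_ *: 1]mulr1 /g -!sumrB -big_split -sumrB.
    apply: eq_bigr => a _ /=.
    rewrite [(y' - u) _ _](_ : _ = (y - u) a.1 a.2 + h a.1 a.2); last first.
      by rewrite !mxE; ring.
    by ring.
  rewrite (le_trans (ler_norm_sum _ _ _))// /C mulr_suml ler_sum// => a _.
  rewrite (le_trans (ler_normD _ _))// !normrM mulrDl.
  have ch : `|c y' t - c y t| <= `|h|.
    by rewrite cc normrZ; case/andP: t01 => t0 t1; rewrite ger0_norm// ler_piMl.
  apply: lerD.
    rewrite -mulrA ler_pM//.
      rewrite (le_trans (ler_mx_norm_coord _ _ _))// distrC ltW//.
      by move: yr; rewrite -ball_normE.
    by rewrite (le_trans (b2 a))// ler_wpM2l// ler_pXn2r ?nnegrE.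
  rewrite mulrC expr2 mulrA ler_pM ?ler_mx_norm_coord//.
  by rewrite (le_trans (b1 a))// ler_wpM2l.
have bo : open (ball u r) by exact: ball_open.
have Sd (y : 'M[R]_(p, q)) : ball u r y ->
    differentiable S y /\ forall a, mx_partial a S y = A a y.
  move=> yr; apply: (@quadratic_mx_partial _ _ _ S (A ^~ y) y C).
  by near=> y'; apply: key => //; near: y'; exact: open_nbhs_nbhs.
exists (ball u r), S; split => //; last by move=> a y /Sd[_ ->].
(* The first derivatives of [S] are the [A a] on the ball, so adjoining [S] to the iterated
   derivatives of the [A b] gives a stable class. *)
apply: (@smooth_on_coind R p q (ball u r)
  (fun f => f = S \/ exists b s, f = foldr (@mx_partial R p q) (A b) s)) => //.
- move=> f x [->|[b [s ->]]] xr; first by have [] := Sd x xr.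
  exact: As (VU _ xr).
- move=> f a [->|[b [s ->]]].
  + exists (A a); first by right; exists a, [::].
    by move=> x; rewrite inE => /Sd[_ ->].
  + exists (mx_partial a (foldr (@mx_partial R p q) (A b) s)) => //.
    by right; exists b, (a :: s).
- by left.
Unshelve. all: by end_near. Qed.

(** * Jet calculus for functions of the fields alone *)

Lemma fsbig_nat0 (R : realType) (f : nat -> R) :
  (forall k, f k.+1 = 0) -> \sum_(k \in [set: nat]) f k = f 0%N.
Proof.
move=> f0; rewrite -(@fsbig_widen _ _ _ _ [set 0%N])//=.
  by rewrite fsbig_set1.
by move=> [|k] [_ /= k0]; [case: k0|exact: f0].
Qed.

Lemma jet_partial_order0 (R : realType) (N : nat) (i : 'I_N) (g : 'rV[R]_N -> R)
    (j : jet R N) :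
  jet_partial 0 i (fun j => g (j 0%N)) j = partial i g (j 0%N).
Proof.
rewrite /jet_partial /partial /mx_partial /derive1 /derive /jet_shift /=.
congr (lim _); apply: (congr1 (fun k => k @ 0^')); apply/funext => h.
by rewrite addr0 scale0r addr0 [X in g X - _]addrC.
Qed.

Lemma jet_partial_order0S (R : realType) (N k : nat) (i : 'I_N)
    (g : 'rV[R]_N -> R) : jet_partial k.+1 i (fun j => g (j 0%N)) = fun=> 0.
Proof. by apply/funext => j; exact: (derive1_cst (g (j 0%N))). Qed.

Lemma total_deriv_order0 (R : realType) (N : nat) (g : 'rV[R]_N -> R)
    (j : jet R N) :
  total_deriv (fun j => g (j 0%N)) j =
  \sum_(i < N) j 1%N ord0 i * partial i g (j 0%N).
Proof.
rewrite /total_deriv fsbig_nat0.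
  by under eq_bigr do rewrite jet_partial_order0.
by move=> k; rewrite big1// => i _; rewrite jet_partial_order0S mulr0.
Qed.

Lemma total_deriv0 (R : realType) (N : nat) :
  total_deriv (fun _ : jet R N => 0) = fun=> 0.
Proof.
apply/funext => j; rewrite (total_deriv_order0 (fun=> 0)) big1// => i _.
by rewrite /partial /mx_partial derive_cst mulr0.
Qed.

Lemma var_deriv_order0 (R : realType) (N : nat) (i : 'I_N) (g : 'rV[R]_N -> R) :
  var_deriv i (fun j => g (j 0%N)) = fun j => partial i g (j 0%N).
Proof.
apply/funext => j; rewrite /var_deriv fsbig_nat0.
  by rewrite expr0 mul1r /= jet_partial_order0.
move=> k; rewrite jet_partial_order0S.
rewrite (_ : iter _ _ _ = fun=> 0) ?mulr0//.
by elim: k.+1 => //= l ->; exact: total_deriv0.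
Qed.

(** * The bracket density and its closedness condition *)

(** The coefficient [A_k] of [u^k_x] in the density of [{I_n, I_m}]. *)
Definition bracket_coef (R : realType) (N : nat) (eta : 'M[R]_N)
    (Phi : 'rV[R]_N -> R) (n m k : 'I_N) : 'rV[R]_N -> R := fun u =>
  \sum_(a < N) \sum_(b < N)
    eta a b * (partial a (partial n Phi) u * partial3 Phi k b m u).

Lemma bracketE (R : realType) (N : nat) (eta : 'M[R]_N) (Phi : 'rV[R]_N -> R)
    (n m : 'I_N) (j : jet R N) :
  bracket eta (integral_density Phi n) (integral_density Phi m) j =
  \sum_(k < N) j 1%N ord0 k * bracket_coef eta Phi n m k (j 0%N).
Proof.
rewrite /bracket.
under eq_bigr => a _ do under eq_bigr => b _ do
  rewrite !var_deriv_order0 total_deriv_order0 mulr_sumr.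
under [RHS]eq_bigr => k _ do rewrite mulr_sumr.
rewrite [RHS]exchange_big; apply: eq_bigr => a _ /=.
under [RHS]eq_bigr => k _ do rewrite mulr_sumr.
rewrite [RHS]exchange_big; apply: eq_bigr => b _ /=.
apply: eq_bigr => k _; rewrite /partial3.
by move: (partial _ _ _) (partial _ _ _) => x y; ring.
Qed.

(** The product rule, arranged so that the fourth derivatives of [Phi] are confined to the second
    double sum. *)
Lemma partial_bracket_coef (R : realType) (N : nat) (eta : 'M[R]_N)
    (U : set 'rV[R]_N) (Phi : 'rV[R]_N -> R) (n m k l : 'I_N) (u : 'rV[R]_N) :
  smooth_on U Phi -> U u ->
  partial l (bracket_coef eta Phi n m k) u =
  \sum_(a < N) \sum_(b < N)
    eta a b * (partial3 Phi l a n u * partial3 Phi k b m u) +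
  \sum_(a < N) \sum_(b < N)
    eta a b * (partial a (partial n Phi) u * partial l (partial3 Phi k b m) u).
Proof.
move=> Ps Uu; rewrite -big_split.
have df f : smooth_on U f -> is_derive u (delta_mx ord0 l) f (partial l f u).
  move=> fs; apply/derivableP/diff_derivable.
  exact: smooth_on_differentiable fs Uu.
apply: derive_val; apply: is_derive_fsum => a /=.
rewrite -big_split; apply: is_derive_fsum => b /=; rewrite -mulrDr.
apply: is_deriveZ.
have d1 := df _ (smooth_on_mx_partial (ord0, a)
  (smooth_on_mx_partial (ord0, n) Ps)).
have d2 := df (partial3 Phi k b m) (smooth_on_mx_partial (ord0, k)
  (smooth_on_mx_partial (ord0, b) (smooth_on_mx_partial (ord0, m) Ps))).
apply: (is_derive_eq (is_deriveM d1 d2)).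
by rewrite [LHS]addrC /GRing.scale /= [X in X + _ = _]mulrC.
Qed.

Lemma partial3C12 (R : realType) (N : nat) (U : set 'rV[R]_N)
    (Phi : 'rV[R]_N -> R) (i j k : 'I_N) (u : 'rV[R]_N) :
  open U -> smooth_on U Phi -> U u -> partial3 Phi i j k u = partial3 Phi j i k u.
Proof.
move=> Uo Ps Uu.
exact: mx_partialC Uo (smooth_on_mx_partial (ord0, k) Ps) Uu.
Qed.

(** The inner exchange holds on a whole neighbourhood of [u], so it survives the outer
    derivative. *)
Lemma partial3C23 (R : realType) (N : nat) (U : set 'rV[R]_N)
    (Phi : 'rV[R]_N -> R) (i j k : 'I_N) (u : 'rV[R]_N) :
  open U -> smooth_on U Phi -> U u -> partial3 Phi i j k u = partial3 Phi i k j u.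
Proof.
move=> Uo Ps Uu; apply: near_eq_derive; near=> x.
by apply: (mx_partialC _ _ Uo Ps); near: x; exact: open_nbhs_nbhs.
Unshelve. all: by end_near. Qed.

Lemma associativity_closed (R : realType) (N : nat) (eta : 'M[R]_N)
    (U : set 'rV[R]_N) (Phi : 'rV[R]_N -> R) : open U -> smooth_on U Phi ->
  associativity_eqs eta U Phi <->
  forall n m k l u, U u ->
    partial l (bracket_coef eta Phi n m k) u =
    partial k (bracket_coef eta Phi n m l) u.
Proof.
move=> Uo Ps.
have sumE n m k l u : U u ->
    \sum_(a < N) \sum_(b < N)
      eta a b * (partial3 Phi l a n u * partial3 Phi k b m u) =
    \sum_(a < N) \sum_(b < N)
      eta a b * partial3 Phi n l a u * partial3 Phi b k m u.
  move=> Uu; apply: eq_bigr => a _; apply: eq_bigr => b _.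
  rewrite (partial3C23 l a n Uo Ps Uu) (partial3C12 l n a Uo Ps Uu).
  by rewrite (partial3C12 k b m Uo Ps Uu) mulrA.
(* The fourth-derivative terms are symmetric in [k] and [l], by exchanging these two derivatives of
   [partial b (partial m Phi)], so they cancel in the closedness condition. *)
have fourE n m k l u : U u ->
    \sum_(a < N) \sum_(b < N)
      eta a b * (partial a (partial n Phi) u * partial l (partial3 Phi k b m) u) =
    \sum_(a < N) \sum_(b < N)
      eta a b * (partial a (partial n Phi) u * partial k (partial3 Phi l b m) u).
  move=> Uu; apply: eq_bigr => a _; apply: eq_bigr => b _.
  have Pbm := smooth_on_mx_partial (ord0, b) (smooth_on_mx_partial (ord0, m) Ps).
  have -> // : partial l (partial3 Phi k b m) u = partial k (partial3 Phi l b m) u.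
  exact: mx_partialC Uo Pbm Uu.
have eqE n m k l u (Uu : U u) :
    (partial l (bracket_coef eta Phi n m k) u =
     partial k (bracket_coef eta Phi n m l) u) <->
    (\sum_(a < N) \sum_(b < N)
      eta a b * partial3 Phi n l a u * partial3 Phi b k m u =
     \sum_(a < N) \sum_(b < N)
      eta a b * partial3 Phi n k a u * partial3 Phi b l m u).
  have E1 := etrans (partial_bracket_coef eta n m k l Ps Uu)
    (f_equal2 +%R (sumE n m k l u Uu) (fourE n m k l u Uu)).
  have E2 := etrans (partial_bracket_coef eta n m l k Ps Uu)
    (f_equal2 +%R (sumE n m l k u Uu) erefl).
  rewrite E1 E2.
  by split=> [E|E]; [exact: (addIr _ E)|exact: (congr1 (+%R^~ _) E)].
split=> [assoc n m k l u Uu|closed u Uu n l k m].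
  exact: ((eqE n m k l u Uu).2 (assoc u Uu n l k m)).
exact: ((eqE n m k l u Uu).1 (closed n m k l u Uu)).
Qed.

(** * Closed forms and total derivatives *)

Lemma row_continuous (R : realType) (p q : nat) (i : 'I_p) :
  continuous (row i : 'M[R]_(p, q) -> 'rV[R]_q).
Proof.
move=> M A /nbhs_ballP[e e0 eA]; apply/nbhs_ballP; exists e => // M' [_ MM'].
by apply: eA; split=> // k l; rewrite !mxE; exact: MM'.
Qed.

(** [S] is given by [F] only over [V], but [V] is open, so small shifts of the order-zero coordinate
    stay in it. *)
Lemma jet_partial_finite_order (R : realType) (N d : nat) (V : set 'rV[R]_N)
    (F : 'M[R]_(d.+1, N) -> R) (S : jet R N -> R) (i : 'I_N) (j : jet R N) :
  open V -> smooth_on [set M | V (row ord0 M)] F ->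
  (forall j, V (j 0%N) -> S j = F (\matrix_(k < d.+1) j k)) -> V (j 0%N) ->
  jet_partial 0 i S j = mx_partial (ord0, i) F (\matrix_(k < d.+1) j k).
Proof.
move=> Vo Fs SF Vj; set X := \matrix_(k < d.+1) j k.
have dF : differentiable F X.
  by apply: (smooth_on_differentiable Fs); rewrite /= rowK.
pose D : 'M[R]_(d.+1, N) := delta_mx ord0 i.
have cshift : (fun t : R => j 0%N + t *: delta_mx ord0 i : 'rV[R]_N) t
    @[t --> (0 : R)] --> j 0%N.
  rewrite -[X in _ --> X]addr0 -[X in _ + X](scale0r (delta_mx ord0 i)).
  by apply: cvgD; [exact: cvg_cst|apply: cvgZr_tmp; exact: cvg_id].
have near_F : \forall t \near (0 : R),
    S (jet_shift 0 i t j) = F (X + t *: D).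
  have : \forall t \near (0 : R), V (j 0%N + t *: delta_mx ord0 i).
    by apply: cshift; exact: open_nbhs_nbhs.
  apply: filterS => t Vt; rewrite SF//; congr F; apply/matrixP => k l.
  rewrite !mxE /jet_shift -[k == ord0]/((k : nat) == 0%N).
  by case: eqP => _; rewrite ?mulr0 ?addr0// !mxE.
rewrite /jet_partial derive1E (near_eq_derive _ near_F).
have := @is_derive_line R _ _ F X D 0.
rewrite scale0r addr0 => /(_ (diff_derivable dF)) dl.
exact: derive_val.
Qed.

(* The identity is tested on the jets [(w, t delta_i, 0, 0, ...)] with [t -> 0],
   where the total derivative reduces to its [u_x]-terms. *)
Lemma total_deriv_linear_coef (R : realType) (N d : nat) (V : set 'rV[R]_N)
    (F : 'M[R]_(d.+1, N) -> R) (S : jet R N -> R) (A : 'I_N -> 'rV[R]_N -> R)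
    (i : 'I_N) (w : 'rV[R]_N) :
  open V -> smooth_on [set M | V (row ord0 M)] F ->
  (forall j, V (j 0%N) -> S j = F (\matrix_(k < d.+1) j k)) ->
  (forall j, V (j 0%N) ->
    \sum_(k < N) j 1%N ord0 k * A k (j 0%N) = total_deriv S j) -> V w ->
  A i w = mx_partial (ord0, i) F (\matrix_(k < d.+1) if k == ord0 then w else 0).
Proof.
move=> Vo Fs SF AS Vw; set X := \matrix_k _.
(* When [d = 0] there is no row 1 and [D] is zero; the argument covers this case unchanged. *)
pose D : 'M[R]_(d.+1, N) :=
  \matrix_(k < d.+1) if (k : nat) == 1%N then delta_mx ord0 i else 0.
pose j (t : R) : jet R N := fun l =>
  if l == 0%N then w else if l == 1%N then t *: delta_mx ord0 i else 0.
have jE t : \matrix_(k < d.+1) j t k = X + t *: D.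
  apply/matrixP => k l; rewrite !mxE -[k == ord0]/((k : nat) == 0%N) /j.
  case: eqP => [->|_]; first by rewrite mxE mulr0 addr0.
  by case: eqP => _; rewrite !mxE ?mulr0 add0r.
(* Both sides of the identity carry the factor [t], which cancels only for nonzero [t]; the value at
   [t = 0] is then recovered by continuity. *)
have Aline t : t != 0 -> A i w = mx_partial (ord0, i) F (X + t *: D).
  move=> t0; have := AS (j t) Vw; rewrite /total_deriv fsbig_nat0; last first.
    by move=> k; rewrite big1// => l _; rewrite mxE mul0r.
  under [RHS]eq_bigr => k _ do
    rewrite (@jet_partial_finite_order R N d V F S k (j t) Vo Fs SF Vw) jE.
  rewrite (bigD1 i)//= [RHS](bigD1 i)//= !big1; last 2 first.
  - by move=> k ki; rewrite !mxE /= (negbTE ki) mulr0 mul0r.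
  - by move=> k ki; rewrite !mxE /= (negbTE ki) mulr0 mul0r.
  by rewrite !addr0 !mxE !eqxx /= mulr1 => /(mulfI t0).
pose G := mx_partial (ord0, i) F.
have dG : differentiable G X.
  apply: (smooth_on_differentiable (smooth_on_mx_partial _ Fs)).
  by rewrite /= rowK eqxx.
have Gc : {for (0 : R), continuous (fun t : R => G (X + t *: D))}.
  apply/differentiable_continuous/derivable1_diffP.
  have := @is_derive_line R _ _ G X D 0.
  by rewrite scale0r addr0 => /(_ (diff_derivable dG)) [].
have G0 : G (X + t *: D) @[t --> (0 : R)^'] --> G X.
  by move/continuous_withinNx : Gc; rewrite /= scale0r addr0.
have GA : G (X + t *: D) @[t --> (0 : R)^'] --> A i w.
  apply: cvg_near_cst; near=> t; apply/esym/Aline; near: t.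
  exact: nbhs_dnbhs_neq.
exact: cvg_unique GA G0.
Unshelve. all: by end_near. Qed.

Lemma partial_jet_section (R : realType) (N d : nat)
    (G : 'M[R]_(d.+1, N) -> R) (i : 'I_N) (w : 'rV[R]_N) :
  partial i (fun w => G (\matrix_(k < d.+1) if k == ord0 then w else 0)) w =
  mx_partial (ord0, i) G (\matrix_(k < d.+1) if k == ord0 then w else 0).
Proof.
rewrite /partial /mx_partial /derive /=.
congr (lim _); apply: (congr1 (fun k => k @ 0^')); apply/funext => h.
congr (_ *: (G _ - _)); apply/matrixP => k l; rewrite !mxE.
by case: eqP => _; rewrite !mxE ?mulr0 ?addr0.
Qed.

(** Near [u] the form is the gradient of the section [w -> F(w, 0, ..., 0)], so the claim becomes
    symmetry of second derivatives of [F]. *)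
Lemma functional_eq0_closed (R : realType) (N : nat) (U : set 'rV[R]_N)
    (A : 'I_N -> 'rV[R]_N -> R) (k l : 'I_N) (u : 'rV[R]_N) :
  functional_eq0 U (fun j => \sum_(k < N) j 1%N ord0 k * A k (j 0%N)) -> U u ->
  partial l (A k) u = partial k (A l) u.
Proof.
move=> A0 /A0[V [Vo Vu _ [S [[d [F [Fs SF]]] AS]]]].
have near_A i : \forall w \near u, A i w =
    mx_partial (ord0, i) F (\matrix_(k < d.+1) if k == ord0 then w else 0).
  near=> w; apply: (total_deriv_linear_coef i Vo Fs SF AS).
  by near: w; exact: open_nbhs_nbhs.
rewrite [LHS](near_eq_derive _ (near_A k)) [RHS](near_eq_derive _ (near_A l)).
rewrite [LHS]partial_jet_section [RHS]partial_jet_section.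
apply: mx_partialC _ Fs _; last by rewrite /= rowK eqxx.
by apply: open_comp Vo => M _; exact: row_continuous.
Unshelve. all: by end_near. Qed.

Lemma closed_functional_eq0 (R : realType) (N : nat) (U : set 'rV[R]_N)
    (A : 'I_N -> 'rV[R]_N -> R) :
  open U -> (forall k, smooth_on U (A k)) ->
  (forall k l u, U u -> partial l (A k) u = partial k (A l) u) ->
  functional_eq0 U (fun j => \sum_(k < N) j 1%N ord0 k * A k (j 0%N)).
Proof.
move=> Uo As Acl u Uu.
have [|V [S [Vo Vu VU Ss SA]]] :=
  @poincare R 1 N U (fun a => A a.2) u Uo (fun a => As a.2) _ Uu.
  by move=> [a1 a2] [b1 b2] x Ux; rewrite !ord1; exact: Acl.
exists V; split => //; exists (fun j : jet R N => S (j 0%N)); split.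
  (* With [d = 0] a jet matrix is a single row, so the primitive [S] itself serves as the function
     of finite order. *)
  have jet0 (M : 'rV[R]_N) : row ord0 M = M by exact: row_id.
  exists 0%N, S; split=> [|j _].
    by apply: smooth_on_subset Ss => M /=; rewrite jet0.
  by congr S; apply/rowP => k; rewrite mxE.
move=> j Vj; rewrite total_deriv_order0; apply: eq_bigr => k _.
by rewrite /partial SA.
Qed.

Lemma smooth_on_bracket_coef (R : realType) (N : nat) (eta : 'M[R]_N)
    (U : set 'rV[R]_N) (Phi : 'rV[R]_N -> R) (n m k : 'I_N) :
  open U -> smooth_on U Phi -> smooth_on U (bracket_coef eta Phi n m k).
Proof.
move=> Uo Ps; do 2! (apply: smooth_on_sum => // ?).
apply: smooth_onM => //; first exact: smooth_on_cst.
by apply: smooth_onM => //; do !apply: smooth_on_mx_partial.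
Qed.

Theorem lemma7p2 (R : realType) (N : nat) (eta : 'M[R]_N)
    (eta_sym : eta^T = eta) (eta_nondeg : eta \in unitmx)
    (U : set 'rV[R]_N) (U_open : open U)
    (Phi : 'rV[R]_N -> R) (Phi_smooth : smooth_on U Phi) :
  in_involution eta U (integral_density Phi) <-> associativity_eqs eta U Phi.
Proof.
have bracket_fun n m :
    bracket eta (integral_density Phi n) (integral_density Phi m) =
    fun j => \sum_(k < N) j 1%N ord0 k * bracket_coef eta Phi n m k (j 0%N).
  by apply/funext => j; exact: bracketE.
(* Associativity is traded for closedness of all the forms, which is then matched with the vanishing
   of each bracket separately. *)
apply: iff_trans (iff_sym (associativity_closed eta U_open Phi_smooth)).
split=> [inv n m k l u Uu|closed n m].
  have := inv n m; rewrite bracket_fun => inv_nm.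
  exact: (@functional_eq0_closed R N U (bracket_coef eta Phi n m) k l u inv_nm Uu).
rewrite bracket_fun; apply: (closed_functional_eq0 U_open _ (closed n m)) => k.
exact: smooth_on_bracket_coef.
Qed.
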